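(* Let $\mathcal{A}$ be an $\epsilon$-differentially private algorithm with domain $\mathcal{X}^n$. Then $I_\infty(\mathcal{A},n)\le\log e\cdot\epsilon n$.
   Context: All random variables take values in finite domains; $\log$ is the binary logarithm. For random variables $\boldsymbol{U},\boldsymbol{V}$ over the same domain $\mathcal{D}$, $D_\infty(\boldsymbol{U}\|\boldsymbol{V})=\log\max_{x\in\mathcal{D}}\frac{\Pr[\boldsymbol{U}=x]}{\Pr[\boldsymbol{V}=x]}$. A randomized algorithm $\mathcal{A}$ with domain $\mathcal{X}^n$ is $\epsilon$-differentially private if for all pairs $S,S'\in\mathcal{X}^n$ that differ in a single element, $D_\infty(\mathcal{A}(S)\|\mathcal{A}(S'))\le\log(e^\epsilon)$. For jointly distributed random variables $\boldsymbol{X},\boldsymbol{Y}$, $\boldsymbol{X}\times\boldsymbol{Y}$ denotes the random variable obtained by drawing them independently from their marginal distributions, and the max-information is $I_\infty(\boldsymbol{X};\boldsymbol{Y})=D_\infty((\boldsymbol{X},\boldsymbol{Y})\|\boldsymbol{X}\times\boldsymbol{Y})$. $I_\infty(\mathcal{A},n)\le k$ means that for every distribution $\mathcal{S}$ over $\mathcal{X}^n$ and $\boldsymbol{S}$ chosen randomly according to $\mathcal{S}$, $I_\infty(\boldsymbol{S};\mathcal{A}(\boldsymbol{S}))\le k$. *)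

(* Defs.v *)
From mathcomp Require Import all_boot all_order all_algebra.
From mathcomp Require Import boolp reals ereal sequences exp.

Set Implicit Arguments.
Unset Strict Implicit.
Unset Printing Implicit Defensive.

Import Order.TTheory GRing.Theory Num.Theory.

Local Open Scope ring_scope.
Local Open Scope ereal_scope.

(* A random variable with values in the finite domain T, up to equality in
   law: only laws (and joint laws) matter for the quantities below. *)
Record fdist (R : realType) (T : finType) := FDist {
  pmf :> T -> R;
  pmf_ge0 : forall x, (0 <= pmf x)%R;
  pmf_sum1 : (\sum_(x : T) pmf x = 1)%R
}.

Section JointLaws.
Variables (R : realType) (T U : finType).

Section Marginals.
Variable P : fdist R (T * U)%type.

Definition fst_pmf (x : T) : R := (\sum_(y : U) P (x, y))%R.
Definition snd_pmf (y : U) : R := (\sum_(x : T) P (x, y))%R.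

Lemma fst_pmf_ge0 x : (0 <= fst_pmf x)%R.
Proof. by apply: sumr_ge0 => y _; exact: pmf_ge0. Qed.

Lemma snd_pmf_ge0 y : (0 <= snd_pmf y)%R.
Proof. by apply: sumr_ge0 => x _; exact: pmf_ge0. Qed.

Lemma fst_pmf_sum1 : (\sum_x fst_pmf x = 1)%R.
Proof.
by rewrite /fst_pmf pair_bigA /= -[RHS](pmf_sum1 P); apply: eq_bigr => -[].
Qed.

Lemma snd_pmf_sum1 : (\sum_y snd_pmf y = 1)%R.
Proof.
rewrite /snd_pmf exchange_big pair_bigA /= -[RHS](pmf_sum1 P).
by apply: eq_bigr => -[].
Qed.

Definition fst_marginal : fdist R T := FDist fst_pmf_ge0 fst_pmf_sum1.
Definition snd_marginal : fdist R U := FDist snd_pmf_ge0 snd_pmf_sum1.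
End Marginals.

Section Joint.
Variables (S : fdist R T) (A : T -> fdist R U).

Definition joint_pmf (z : T * U) : R := (S z.1 * A z.1 z.2)%R.

Lemma joint_pmf_ge0 z : (0 <= joint_pmf z)%R.
Proof. by apply: mulr_ge0; exact: pmf_ge0. Qed.

Lemma joint_pmf_sum1 : (\sum_z joint_pmf z = 1)%R.
Proof.
rewrite -(pair_bigA _ (fun x y => S x * A x y)%R) /= -[RHS](pmf_sum1 S).
by apply: eq_bigr => x _; rewrite -mulr_sumr pmf_sum1 mulr1.
Qed.

(* The joint law of (X, A(X)), for X of law S and the internal randomness of A
   independent of X. *)
Definition joint : fdist R (T * U)%type := FDist joint_pmf_ge0 joint_pmf_sum1.
End Joint.
End JointLaws.

Definition indep_prod (R : realType) (T U : finType)
    (P : fdist R T) (Q : fdist R U) : fdist R (T * U)%type :=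
  joint P (fun=> Q).

Definition log2 (R : realType) (x : \bar R) : \bar R :=
  lne x * ((ln 2)^-1)%:E.

(* The quotient is that of \bar R, where a / 0 = +oo for a > 0 and 0 / 0 = 0:
   the divergence is +oo if V misses a point of the support of U, and points
   of probability zero under both laws do not contribute. *)
Definition Dinfty (R : realType) (D : finType) (U V : fdist R D) : \bar R :=
  log2 (\big[maxe/-oo]_(x : D) ((U x)%:E / (V x)%:E)).

Definition max_info (R : realType) (T U : finType) (P : fdist R (T * U)%type) :
  \bar R := Dinfty P (indep_prod (fst_marginal P) (snd_marginal P)).

Definition algorithm (R : realType) (X : finType) (n : nat) (Y : finType) :=
  n.-tuple X -> fdist R Y.

Definition differ_in_one (X : finType) (n : nat) (s s' : n.-tuple X) : bool :=
  #|[set i : 'I_n | tnth s i != tnth s' i]| == 1%N.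

Definition differentially_private (R : realType) (X : finType) (n : nat)
    (Y : finType) (eps : R) (A : algorithm R X n Y) : Prop :=
  forall s s' : n.-tuple X, differ_in_one s s' ->
    Dinfty (A s) (A s') <= log2 (expR eps)%:E.

Definition alg_max_info_le (R : realType) (X : finType) (n : nat)
    (Y : finType) (A : algorithm R X n Y) (k : \bar R) : Prop :=
  forall S : fdist R (n.-tuple X), max_info (joint S A) <= k.

(* Main.v *)
Require Import Defs.
From mathcomp Require Import all_boot all_order all_algebra.
From mathcomp Require Import boolp reals ereal sequences exp.

Import Order.TTheory GRing.Theory Num.Theory.

Local Open Scope ring_scope.
Local Open Scope ereal_scope.

(** Any two datasets are joined by a chain of at most [n] single-element changes,
    so pointwise [Pr[A(s) = y] <= e^(eps n) Pr[A(s') = y]] for all [s] and [s'].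
    Averaging over [s'] bounds [Pr[A(s) = y]] by [e^(eps n)] times the marginal
    probability of [y], and this is the bound on the ratio of the joint law to
    the product of its marginals. *)

Lemma log2_expR (R : realType) (a : R) : log2 (expR a)%:E = (a / ln 2)%:E.
Proof. by rewrite /log2 lne_EFin ?expR_gt0// expRK. Qed.

Lemma log2_le_expR (R : realType) (x : \bar R) (a : R) :
  (log2 x <= log2 (expR a)%:E) = (x <= (expR a)%:E).
Proof.
have ln2_gt0 : (0 < (ln 2 : R)^-1)%R by rewrite invr_gt0 ln_gt0 // ltr1n.
rewrite log2_expR /log2 EFinM lee_pmul2r ?fin_numE //.
have [x_gt0|x_le0] := ltP 0 x.
  have /eqP {2}<- : expeR (lne x) == x by rewrite lneK_eq ltW.
  by rewrite -[LHS]lee_expeR.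
(* For [x <= 0] the logarithm is [-oo], so both inequalities hold. *)
by rewrite le0_lneNy // leNye (le_trans x_le0) // lee_fin expR_ge0.
Qed.

(** Clearing the denominator is safe even where [V x = 0]: the ratio is then [+oo] unless [U x = 0],
    and the product form likewise forces [U x = 0]. *)
Lemma Dinfty_le_expR (R : realType) (D : finType) (U V : fdist R D) (a : R) :
  Dinfty U V <= log2 (expR a)%:E <-> forall x, (U x <= expR a * V x)%R.
Proof.
have ratio_le x :
    ((U x)%:E / (V x)%:E <= (expR a)%:E) = (U x <= expR a * V x)%R.
  have := pmf_ge0 V x; rewrite le_eqVlt => /predU1P[<-|V_gt0].
    rewrite inver eqxx mulr0.
    have := pmf_ge0 U x; rewrite le_eqVlt => /predU1P[<-|U_gt0].
      by rewrite mul0e lexx lee_fin expR_ge0.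
    by rewrite gt0_muley ?lte_fin // leye_eq /= leNgt U_gt0.
  by rewrite inver gt_eqF // -EFinM lee_fin ler_pdivrMr.
rewrite /Dinfty log2_le_expR; split => [/bigmax_leP[_ le_ratio] x|le_pmf].
  by rewrite -ratio_le; exact: le_ratio.
by apply/bigmax_leP; split=> [|x _]; rewrite ?leNye // ratio_le.
Qed.

Section GroupPrivacy.
Variables (R : realType) (X Y : finType) (n : nat) (eps : R).
Variable A : algorithm R X n Y.
Hypotheses (eps_ge0 : (0 <= eps)%R) (A_dp : differentially_private eps A).

(** The chain of hybrid datasets: it runs from [s'] at [k = 0] to [s] at [k = n]. *)
Definition splice (k : nat) (s s' : n.-tuple X) : n.-tuple X :=
  [tuple if (i < k)%N then tnth s i else tnth s' i | i < n].

(** Only index [k] can change. Equality is a separate case because [differ_in_one] demands exactly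
    one change, and there is none if [s] and [s'] agree at [k] or if [k >= n]. *)
Lemma spliceS_diff (k : nat) (s s' : n.-tuple X) :
  (splice k.+1 s s' = splice k s s') \/
  differ_in_one (splice k.+1 s s') (splice k s s').
Proof.
rewrite /differ_in_one; set D := [set i | _].
have D_eq_k i : i \in D -> i = k :> nat.
  rewrite inE !tnth_mktuple ltnS leq_eqVlt.
  by case: (i =P k :> nat) => //= _; rewrite eqxx.
have [D0|[i iD]] := set_0Vmem D.
  left; apply: eq_from_tnth => i; apply/eqP; rewrite -[_ == _]negbK.
  by have := in_set0 i; rewrite -D0 inE => ->.
right; apply/cards1P; exists i; apply/setP => j; rewrite inE.
apply/idP/eqP => [jD|-> //]; apply: val_inj.
by rewrite /= (D_eq_k _ jD) (D_eq_k _ iD).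
Qed.

Lemma splice_privacy (k : nat) (s s' : n.-tuple X) (y : Y) :
  (A (splice k s s') y <= expR (eps * k%:R) * A s' y)%R.
Proof.
elim: k => [|k IHk].
  have -> : splice 0 s s' = s' by apply: eq_from_tnth => i; rewrite tnth_mktuple.
  by rewrite mulr0 expR0 mul1r.
rewrite mulrSr mulrDr mulr1 addrC expRD -mulrA.
apply: (@le_trans _ _ (expR eps * A (splice k s s') y)%R); last first.
  by rewrite ler_wpM2l // expR_ge0.
have [->|diff1] := spliceS_diff k s s'.
  (* A step that changes nothing costs a factor [1 <= expR eps], by [eps_ge0]. *)
  by rewrite ler_peMl ?pmf_ge0 // -[leLHS]expR0 ler_expR.
exact: (proj1 (Dinfty_le_expR _ _ _ _ _) (A_dp _ _ diff1) y).
Qed.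

Lemma group_privacy (s s' : n.-tuple X) (y : Y) :
  (A s y <= expR (eps * n%:R) * A s' y)%R.
Proof.
have {1}<- : splice n s s' = s.
  by apply: eq_from_tnth => i; rewrite tnth_mktuple ltn_ord.
exact: splice_privacy.
Qed.

End GroupPrivacy.

Theorem theorem19 (R : realType) (X Y : finType) (n : nat) (eps : R)
    (A : algorithm R X n Y) (eps_ge0 : (0 <= eps)%R)
    (A_dp : differentially_private eps A) :
  alg_max_info_le A (log2 (expR 1)%:E * (eps * n%:R)%:E).
Proof.
have -> : log2 (expR 1)%:E * (eps * n%:R)%:E = log2 (expR (eps * n%:R))%:E.
  by rewrite !log2_expR -EFinM mul1r mulrC.
move=> S; apply/Dinfty_le_expR => -[s y] /=; rewrite /joint_pmf /=.
have -> : fst_pmf (joint S A) s = S s.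
  by rewrite /fst_pmf /= /joint_pmf /= -mulr_sumr pmf_sum1 mulr1.
(* After the common factor [S s] is removed, [A s y] is written as its average over [s'] with
   weights [S s'], to be compared term by term with the marginal at [y]. *)
rewrite mulrCA ler_wpM2l ?pmf_ge0 // -[leLHS]mul1r -[X in (X * _)%R](pmf_sum1 S).
rewrite /snd_pmf /= mulr_suml mulr_sumr; apply: ler_sum => s' _.
rewrite /joint_pmf /= mulrCA ler_wpM2l ?pmf_ge0 //.
exact: group_privacy.
Qed.
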